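(* Assume Dickson's $k$-tuples conjecture. Then $\limsup_{m\in\mathscr{V}^{2}}\mathrm{A}(m)=\infty$; that is, for every $k\ge1$ there exists a totient $m\equiv 4\pmod 8$ with $\mathrm{A}(m)\ge k$. (Consequently $2$ is the smallest $\ell$ for which the multiplicities of totients in $\mathscr{V}^{\ell}$ are unbounded.)
   Context: $\phi$ is Euler's totient function, $\mathscr{V}$ the set of its values, $\mathrm{A}(m)=|\phi^{-1}(m)|$, and $\mathscr{V}^{\ell}=\{m\in\mathscr{V}: m\equiv 2^{\ell}\pmod{2^{\ell+1}}\}$. Dickson's $k$-tuples conjecture: if $a_1n+b_1,\dots,a_kn+b_k$ are linear forms with integer coefficients, $a_i\ge1$, such that for every prime $p$ there is an integer $n$ with $p\nmid\prod_i(a_in+b_i)$ (an admissible tuple), then there are infinitely many positive integers $n$ for which all $a_in+b_i$ are simultaneously prime. *)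

(* Defs.v *)
From mathcomp Require Import all_boot all_order all_algebra finmap.
From mathcomp Require Import all_classical all_reals all_analysis.

Set Implicit Arguments.
Unset Strict Implicit.
Unset Printing Implicit Defensive.

Import Order.TTheory GRing.Theory Num.Theory.

Local Open Scope classical_set_scope.

(* [totient 0 = 0] in MathComp, hence the explicit [0 < n]. *)
Definition totient_fiber (m : nat) : set nat :=
  [set n | 0 < n /\ totient n = m].

Definition totients : set nat := [set m | totient_fiber m !=set0].

(* [fset_set] is only meaningful on finite sets; see
   [finite_totient_fiber] below. *)
Definition multiplicity (m : nat) : nat := #|` fset_set (totient_fiber m)|%fset.

Definition totients_class (l : nat) : set nat :=
  [set m | totients m /\ m = 2 ^ l %[mod 2 ^ l.+1]].

Definition unbounded_multiplicities (l : nat) : Prop :=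
  forall k : nat, exists2 m, totients_class l m & k <= multiplicity m.

Definition int_prime (z : int) : Prop := exists2 p : nat, prime p & z = p%:Z%R.

Section LinearForms.
Variables (k : nat) (a b : 'I_k -> int).
Local Open Scope ring_scope.

Definition admissible : Prop :=
  forall p : nat, prime p ->
    exists n : int, ~~ (p%:Z %| \prod_(i < k) (a i * n + b i))%Z.

Definition simultaneous_primes : set nat :=
  [set n | (0 < n)%N /\ forall i, int_prime (a i * n%:Z + b i)].

End LinearForms.

Definition dickson_conjecture : Prop :=
  forall (k : nat) (a b : 'I_k -> int),
    (forall i, (1 <= a i)%R) -> admissible a b ->
    infinite_set (simultaneous_primes a b).

Lemma leq_totient_sqr n : 0 < n -> n <= (~~ odd n).+1 * totient n ^ 2.
Proof.
have [N] := ubnP n; elim: N n => // N IHN n; rewrite ltnS => leN n_gt0.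
have [n_le1|n_gt1] := leqP n 1; first by case: n n_gt0 n_le1 {leN} => [|[]].
pose p := pdiv n; have p_pr : prime p by exact: pdiv_prime.
have p_gt1 := prime_gt1 p_pr.
have [m co_pm nE] := pfactor_coprime p_pr n_gt0.
have e_gt0 : 0 < logn p n by rewrite logn_gt0 pi_pdiv.
move: e_gt0 nE; case: (logn p n) => // e _ nE.
have m_gt0 : 0 < m by move: n_gt0; rewrite nE muln_gt0 => /andP[].
have ltmN : m < N.
  apply: leq_trans leN; rewrite nE ltn_Pmulr //.
  by rewrite expnS (leq_trans p_gt1) // leq_pmulr // expn_gt0 prime_gt0.
have /= IHm := IHN m ltmN m_gt0.
have q_gt0 : 0 < p ^ e by rewrite expn_gt0 prime_gt0.
have -> : totient n = totient m * (p.-1 * p ^ e).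
  by rewrite nE totient_coprime ?totient_pfactor // coprime_sym coprimeXl.
rewrite expnMn mulnA; have [p2|p_odd] := even_prime p_pr.
  move: co_pm IHm; rewrite p2 coprime2n => m_odd.
  rewrite m_odd nE p2 oddM oddX /= andbF mul1n => IHm.
  by rewrite mul1n (mulnC 2) -mulnA leq_mul // expnS leq_mul // leq_pmulr // expn_gt0.
have -> : odd n = odd m by rewrite nE oddM oddX p_odd orbT andbT.
rewrite {1}nE leq_mul // expnMn expnS leq_mul //; last by rewrite leq_pmulr.
case: p p_gt1 p_odd {p_pr co_pm nE q_gt0} => [|[|[|p]]] //= _ _.
by rewrite -[leqRHS]/(p.+2 * p.+2) mulSn addSn ltnS addnC -addn1 leq_add // leq_pmulr.
Qed.

Lemma finite_totient_fiber m : finite_set (totient_fiber m).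
Proof.
apply: (@sub_finite_set _ _ `I_(2 * m ^ 2).+1); last exact: finite_II.
move=> n /= [n_gt0 <-]; rewrite ltnS.
by apply: leq_trans (leq_totient_sqr n_gt0) _; rewrite leq_mul2r; case: odd; rewrite orbT.
Qed.

(* Main.v *)
Require Import Defs.
From mathcomp Require Import all_boot all_order all_algebra.
From mathcomp Require Import all_classical all_reals all_analysis.
From mathcomp Require Import finmap zify.

(* For a fixed k and n to be chosen, put c = 4n + 2 and q_i = 3^i c + 1 for
   i <= 2k. Every prime p divides c for some n, and then p divides no q_i, so
   these forms in n are admissible and Dickson's conjecture makes all the q_i
   prime for arbitrarily large n. The k products q_i q_(2k-i) with i < k then
   are distinct preimages of m = 3^(2k) c^2, which is 4 mod 8.
   Conversely, if 4 does not divide phi(n) then n is 1, 2, 4, p^a or 2p^a with p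
   an odd prime; when a > 1, p is the largest prime factor of phi(n), so
   phi(n) determines n up to at most seven possibilities. *)

Set Implicit Arguments.
Unset Strict Implicit.
Unset Printing Implicit Defensive.
Import Order.TTheory GRing.Theory Num.Theory.

Lemma multiplicity_ge (m : nat) (s : seq nat) :
  uniq s -> {in s, forall n, totient_fiber m n} -> size s <= multiplicity m.
Proof.
move=> s_uniq sP; apply: uniq_leq_size => // n /sP mn.
by rewrite in_fset_set ?mem_set //; exact: finite_totient_fiber.
Qed.

Lemma multiplicity_le (m : nat) (s : seq nat) :
  (forall n, totient_fiber m n -> n \in s) -> multiplicity m <= size s.
Proof.
move=> sP; apply: uniq_leq_size => [|n]; first exact: fset_uniq.
by rewrite in_fset_set; [move=> /set_mem /sP | exact: finite_totient_fiber].
Qed.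

Lemma dvdn_pred_totient p n : prime p -> 0 < n -> p %| n -> p.-1 %| totient n.
Proof.
move=> p_pr n_gt0 pn; have [m co_pm nE] := pfactor_coprime p_pr n_gt0.
have e_gt0 : 0 < logn p n by rewrite logn_gt0 mem_primes p_pr n_gt0.
rewrite nE totient_coprime 1?coprime_sym ?coprimeXl //.
by rewrite totient_pfactor // dvdn_mull // dvdn_mulr.
Qed.

(** A power of 2 above 2 has an even power of 2 as totient; otherwise an odd prime p divides n, and
    the even number p - 1 divides the totient. *)
Lemma dvd2_totient n : 2 < n -> 2 %| totient n.
Proof.
move=> n_gt2; have n_gt0 : 0 < n by lia.
have [u u_odd nE] := pfactor_coprime (isT : prime 2) n_gt0.
have [u_le1|u_gt1] := leqP u 1.
  move: n_gt2; rewrite nE; case: u u_odd {nE} u_le1 => [|[]] //= _ _.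
  rewrite mul1n; case: logn => [|[|e]] // _.
  by rewrite totient_pfactor // mul1n dvdn_exp.
have p_pr := pdiv_prime u_gt1; have p_gt1 := prime_gt1 p_pr.
apply: dvdn_trans (dvdn_pred_totient p_pr n_gt0 _).
  have : odd (pdiv u) by apply: dvdn_odd (pdiv_dvd u) _; rewrite -coprime2n.
  by rewrite dvdn2; case: (pdiv u) p_gt1.
by rewrite nE dvdn_mulr // pdiv_dvd.
Qed.

Lemma odd_totient_ndvd4 n : odd n -> 1 < n -> ~~ (4 %| totient n) ->
  exists p e, prime p /\ n = p ^ e.+1.
Proof.
move=> n_odd n_gt1 n4.
pose p := pdiv n; have p_pr : prime p by exact: pdiv_prime.
have n_gt0 : 0 < n by exact: ltnW.
have [m co_pm nE] := pfactor_coprime p_pr n_gt0.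
have e_gt0 : 0 < logn p n by rewrite logn_gt0 pi_pdiv.
move: e_gt0 nE; case: (logn p n) => // e _ nE.
exists p, e; split => //.
suff m1 : m = 1 by rewrite nE m1 mul1n.
move: n_odd; rewrite nE oddM oddX /= => /andP[m_odd p_odd].
have p_gt2 : 2 < p by rewrite odd_prime_gt2.
(* If the odd cofactor [m] is not 1, then both it and the power of [p] exceed 2, so each contributes
   a factor 2 to the totient. *)
case: m m_odd {co_pm} (co_pm) nE => [|[|[|m]]] // _ co_pm nE.
case/negP: n4; rewrite nE totient_coprime 1?coprime_sym ?coprimeXl //.
rewrite (@dvdn_mul 2 2) // dvd2_totient //.
by rewrite (leq_trans p_gt2) // expnS leq_pmulr // expn_gt0 prime_gt0.
Qed.

(** The totient is (p - 1) p^(e+1): since the exponent is at least 2, p survives in it, and any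
    other prime factor divides p - 1. *)
Lemma max_pdiv_totient p e : prime p -> max_pdiv (totient (p ^ e.+2)) = p.
Proof.
move=> p_pr; have p_gt1 := prime_gt1 p_pr.
rewrite totient_pfactor //=.
have m_gt0 : 0 < p.-1 * p ^ e.+1 by rewrite muln_gt0 expn_gt0; lia.
have pm : p %| p.-1 * p ^ e.+1 by rewrite expnS mulnCA dvdn_mulr.
have m_gt1 : 1 < p.-1 * p ^ e.+1 by exact: leq_trans p_gt1 (dvdn_leq _ pm).
apply/eqP; rewrite eqn_leq (max_pdiv_max _) ?mem_primes ?p_pr ?m_gt0 // andbT.
have := max_pdiv_dvd (p.-1 * p ^ e.+1).
rewrite Euclid_dvdM ?max_pdiv_prime // => /orP[/dvdn_leq|].
  by lia.
by rewrite Euclid_dvdX ?max_pdiv_prime // => /andP[/dvdn_leq -> //]; lia.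
Qed.

(** The entries stand for n = 1, n = p and n = p^a with a > 1. In the last case p is the largest
    prime factor of m, and m = (p - 1) p^(a-1) gives n = m p / (p - 1). For m = 1 the third entry is
    the default value 0. *)
Lemma odd_totient_fiber_ndvd4 m n : ~~ (4 %| m) -> odd n -> totient n = m ->
  n \in [:: 1; m.+1; m * max_pdiv m %/ (max_pdiv m).-1].
Proof.
move=> m4 n_odd nm; have [n_le1|n_gt1] := leqP n 1.
  by case: n n_odd n_le1 {nm} => [|[]].
move: m4; rewrite -nm => /(odd_totient_ndvd4 n_odd n_gt1)[p [[|e] [p_pr ->]]].
  rewrite totient_pfactor //= muln1 expn1 prednK ?prime_gt0 //.
  by rewrite !inE eqxx orbT.
rewrite max_pdiv_totient // totient_pfactor //= -mulnA -expnSr mulKn.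
  by rewrite !inE eqxx !orbT.
by have := prime_gt1 p_pr; lia.
Qed.

Lemma multiplicity_ndvd4 m : ~~ (4 %| m) -> multiplicity m <= 7.
Proof.
move=> m4; pose s := [:: 1; m.+1; m * max_pdiv m %/ (max_pdiv m).-1].
apply: (multiplicity_le (s := 4 :: s ++ map (muln 2) s)) => n [n_gt0 nm].
have [u u_odd nE] := pfactor_coprime (isT : prime 2) n_gt0.
have {}u_odd : odd u by rewrite -coprime2n.
have uP : totient u = m -> u \in s by exact: odd_totient_fiber_ndvd4.
have : ~~ (4 %| totient u * totient (2 ^ logn 2 n)).
  by rewrite -totient_coprime -?nE ?nm // coprimeXr // coprimen2.
rewrite in_cons mem_cat; move: nm; rewrite {1 3 4 5}nE.
rewrite totient_coprime ?coprimeXr ?coprimen2 //.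
(* Let j be the exponent of 2 in n. For j <= 1, [u] has totient [m], so n lies in [s] or its double.
   For j = 2, u > 1 would add a second factor 2, so n = 4. For j >= 3, 4 already divides the totient
   of 2^j. *)
case: logn => [|[|[|e]]].
- by rewrite !muln1 => /uP ->; rewrite orbT.
- rewrite muln1 (mulnC u) => /uP us _.
  by rewrite map_f ?orbT.
- have [u_gt1|u_le1] := ltnP 1 u.
    rewrite (@dvdn_mul 2 2) // dvd2_totient //.
    by case: u u_odd u_gt1 {nE uP} => [|[|[]]].
  by case: u u_odd u_le1 {nE uP} => [|[]].
- move=> _; rewrite totient_pfactor // mul1n (@dvdn_mull 4) //.
  by rewrite !expnS mulnA dvdn_mulr.
Qed.

Lemma unbounded_multiplicities_ge2 l : unbounded_multiplicities l -> 2 <= l.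
Proof.
move=> /(_ 8)[m [_ ml] m8]; rewrite leqNgt; apply/negP => l_lt2.
(* Here m is odd for l = 0 and 2 mod 4 for l = 1, so 8 preimages are one too many. *)
have : ~~ (4 %| m) by case: l l_lt2 ml => [|[|]] //= _; lia.
by move=> /multiplicity_ndvd4; rewrite leqNgt m8.
Qed.

Lemma dickson_affine_powers (K N : nat) : dickson_conjecture ->
  exists2 n, N <= n & forall i, i <= K -> prime (3 ^ i * (4 * n + 2)).+1.
Proof.
move=> dickson.
pose a (i : 'I_K.+1) : int := (3 ^ i * 4)%N%:Z%R.
pose b (i : 'I_K.+1) : int := (3 ^ i * 2).+1%N%:Z%R.
have abE i (n : nat) : (a i * n%:Z + b i = (3 ^ i * (4 * n + 2))%N.+1%:Z)%R.
  by rewrite /a /b -PoszM -PoszD; congr Posz; lia.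
have a_ge1 i : (1 <= a i)%R by rewrite /a lez_nat muln_gt0 expn_gt0.
have adm : admissible a b.
  move=> p p_pr; exists (p./2%:Z)%R.
  rewrite (eq_bigr _ (fun i _ => abE i _)) -(big_morph Posz PoszM (erefl _)).
  rewrite dvdzE /= Euclid_dvd_prod // big_has -all_predC; apply/allP => i _ /=.
  have pc : p %| 4 * p./2 + 2.
    have [->//|p_odd] := even_prime p_pr.
    by apply/dvdnP; exists 2; rewrite -[in RHS](odd_double_half p) p_odd; lia.
  by rewrite -addn1 dvdn_addr ?dvdn_mull // Euclid_dvd1.
have [n nP nN] : exists2 n, simultaneous_primes a b n & N <= n.
  apply: contrapT => noN; apply: (dickson _ a b a_ge1 adm).
  apply: (sub_finite_set _ (finite_II N)) => n nP /=.
  by rewrite ltnNge; apply/negP => Nn; apply: noN; exists n.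
exists n => // i iK; have [_ /(_ (Ordinal (iK : i < K.+1)))[p p_pr]] := nP.
by rewrite abE => -[->].
Qed.

(** The bound [N <= m] gives members of the class arbitrarily far out, as the limsup requires. *)
Lemma large_multiplicities (k N : nat) : dickson_conjecture ->
  exists m, [/\ N <= m, totients_class 2 m & k.+1 <= multiplicity m].
Proof.
move=> dickson; have [n Nn] := dickson_affine_powers (k.+1).*2 N dickson.
set c := 4 * n + 2; pose q i := (3 ^ i * c).+1 => q_pr.
have c_gt0 : 0 < c by rewrite /c addn2.
have q_inj i j : (q i == q j) = (i == j).
  by rewrite eqSS eqn_pmul2r // eqn_exp2l.
pose m := 3 ^ (k.+1).*2 * c ^ 2; pose f i := q i * q ((k.+1).*2 - i).
have fm i : i < k.+1 -> totient_fiber m (f i).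
  move=> ik; split=> //.
  have pi : prime (q i) by apply: q_pr; lia.
  have pj : prime (q ((k.+1).*2 - i)) by apply: q_pr; lia.
  (* Since i < k + 1, the index i is below its complement 2(k + 1) - i, so the two primes are
     distinct. *)
  rewrite totient_coprime; last first.
    by rewrite prime_coprime // dvdn_prime2 // q_inj; lia.
  rewrite !totient_prime //= mulnACA -expnD subnKC //; lia.
have f_inj : {in iota 0 k.+1 &, injective f}.
  move=> i j; rewrite !mem_iota !add0n => ik jk fij.
  have pi : prime (q i) by apply: q_pr; lia.
  have : q i %| f j by rewrite -fij dvdn_mulr.
  (* Either i = j or i = 2(k + 1) - j; the latter exceeds k + 1 and is excluded. *)
  rewrite Euclid_dvdM // !dvdn_prime2 //; try (apply: q_pr; lia).
  by rewrite !q_inj; lia.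
exists m; split.
- rewrite /m (leq_trans Nn) // (@leq_trans c) ?/c //; first lia.
  by rewrite -[X in X <= _]mul1n leq_mul ?expn_gt0 // (leq_pexp2l (n1 := 1)).
- split; first by exists (f 0); exact: fm.
  (* As c = 2(2n + 1), [m] is 4 times this odd number, hence 4 mod 8. *)
  have : odd (3 ^ (k.+1).*2 * (2 * n + 1) ^ 2).
    by rewrite oddM !oddX /= oddD oddM.
  rewrite /m (_ : c = 2 * (2 * n + 1)); last by rewrite /c; lia.
  by rewrite expnMn mulnCA; lia.
- rewrite -[k.+1](size_iota 0) -(size_map f); apply: multiplicity_ge.
    by rewrite map_inj_in_uniq ?iota_uniq.
  by move=> _ /mapP[i + ->]; rewrite mem_iota => /fm.
Qed.

Theorem theorem3p2 (R : realType) (dickson : dickson_conjecture) :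
  [/\ limf_esup (fun m : nat => (multiplicity m)%:R%:E : \bar R)
        (within (totients_class 2) \oo%classic) = +oo%E,
      forall k : nat, (1 <= k)%N ->
        exists m : nat, [/\ totients m, (m = 4 %[mod 8])%N
                          & (k <= multiplicity m)%N]
    & unbounded_multiplicities 2 /\
      forall l : nat, unbounded_multiplicities l -> (2 <= l)%N].
Proof.
have classP k : exists2 m, totients_class 2 m & k <= multiplicity m.
  have [m [_ mc /ltnW km]] := large_multiplicities k 0 dickson.
  by exists m.
split; last by split=> //; exact: unbounded_multiplicities_ge2.
  (* A set [V] of the filter contains every member of the class from some [N] on, so the supremum
     over [V] must exceed each real [A]. *)
  apply/ereal_inf_pinfty => _ [V [N _ NV] <-]; apply/eqyP => A _.
  (* The multiplicity is at least [(Num.truncn A).+1], which is larger than [A]. *)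
  have [m [Nm mc km]] := large_multiplicities (Num.truncn A) N dickson.
  apply: (@le_trans _ _ (multiplicity m)%:R%:E%E).
    rewrite lee_fin; apply: le_trans (ltW (truncnS_gt A)) _.
    by rewrite ler_nat.
  by apply: ereal_sup_ubound; exists m => //; exact: NV.
by move=> k _; have [m [mt m4] km] := classP k; exists m.
Qed.
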